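(* Let $p>3$ be a prime and let $\mathcal{P}$ be a nontrivial monotone and non-evasive graph property on $2p$ vertices. Then $\dim\mathcal{P}\geq 4p-1$.
   Context: Graphs are finite and simple. A graph property $\mathcal{P}$ on $n$ vertices is a collection of graphs with vertex set $\{1,\ldots,n\}$ (identified with their edge sets) that is closed under isomorphism of graphs. Its complexity $c(\mathcal{P})$ is the minimum $k$ such that some adaptive strategy of questions of the form ''is $\{i,j\}$ an edge of $G$?'' always determines, for every unknown graph $G$ on $\{1,\ldots,n\}$, whether $G\in\mathcal{P}$ using at most $k$ questions. $\mathcal{P}$ is evasive if $c(\mathcal{P})=\binom{n}{2}$, and non-evasive otherwise. $\mathcal{P}$ is monotone if it is closed under removal of edges. $\mathcal{P}$ is trivial if it is empty or consists of all graphs on $\{1,\ldots,n\}$, and nontrivial otherwise. A nonempty monotone graph property $\mathcal{P}$ is regarded as a simplicial complex on the set of two-element subsets of $\{1,\ldots,n\}$, whose faces are the edge sets of graphs in $\mathcal{P}$; a graph with $m$ edges is a face of dimension $m-1$, so $\dim\mathcal{P}$ is the maximum number of edges of a graph in $\mathcal{P}$ minus $1$. *)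

(* Defs.v *)
From mathcomp Require Import all_boot all_order all_fingroup all_algebra.
From mathcomp Require Import boolp.

Set Implicit Arguments.
Unset Strict Implicit.
Unset Printing Implicit Defensive.

Import GRing.Theory Num.Theory.

(* The vertices 1, ..., n are represented by 'I_n. *)
Definition edge (n : nat) : finType := {e : {set 'I_n} | #|e| == 2}.

Definition graph (n : nat) : finType := {set edge n}.

Definition adjacent n (G : graph n) (i j : 'I_n) : bool :=
  [exists e in G, val e == [set i; j]].

Definition isomorphic n (G H : graph n) : Prop :=
  exists s : 'S_n, forall i j, adjacent H (s i) (s j) = adjacent G i j.

Definition graph_property n (P : {set graph n}) : Prop :=
  forall G H : graph n, isomorphic G H -> G \in P -> H \in P.

Definition monotone n (P : {set graph n}) : Prop :=
  forall G H : graph n, H \subset G -> G \in P -> H \in P.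

Definition trivial n (P : {set graph n}) : Prop := P = set0 \/ P = setT.

(* An adaptive strategy is a decision tree: in [Ask e t_yes t_no] it continues
   with t_yes if e is an edge of the unknown graph and with t_no otherwise. *)
Inductive strategy (n : nat) : Type :=
| Answer of bool
| Ask of edge n & strategy n & strategy n.

Fixpoint answer n (t : strategy n) (G : graph n) : bool :=
  match t with
  | Answer b => b
  | Ask e t_yes t_no => if e \in G then answer t_yes G else answer t_no G
  end.

Fixpoint questions n (t : strategy n) (G : graph n) : nat :=
  match t with
  | Answer _ => 0
  | Ask e t_yes t_no =>
      (if e \in G then questions t_yes G else questions t_no G).+1
  end.

Definition decidable_within n (P : {set graph n}) (k : nat) : Prop :=
  exists t : strategy n, forall G : graph n,
    answer t G = (G \in P) /\ questions t G <= k.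

Fixpoint ask_all n (P : {set graph n}) (s : seq (edge n)) (K : graph n) :
    strategy n :=
  if s is e :: s' then Ask e (ask_all P s' (e |: K)) (ask_all P s' K)
  else Answer n (K \in P).

Lemma ask_allP n (P : {set graph n}) (s : seq (edge n)) (K G : graph n) :
  answer (ask_all P s K) G = (K :|: [set e in s | e \in G] \in P) /\
  questions (ask_all P s K) G = size s.
Proof.
elim: s K => [|e s IHs] K /=.
  by split=> //; congr (_ \in P); apply/setP=> x; rewrite !inE orbF.
case: ifPn => eG.
  have [-> ->] := IHs (e |: K); split=> //; congr (_ \in P).
  apply/setP=> x; rewrite !inE; case: eqVneq => [->|_] //=.
  by rewrite eG orbT.
have [-> ->] := IHs K; split=> //; congr (_ \in P).
apply/setP=> x; rewrite !inE; case: eqVneq => [->|_] //=.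
by rewrite (negPf eG) !andbF.
Qed.

Lemma card_edge n : #|edge n| = 'C(n, 2).
Proof.
by rewrite card_sig -[n in 'C(n, _)]card_ord -card_draws cardsE; apply: eq_card.
Qed.

Lemma decidable_within_bin n (P : {set graph n}) : decidable_within P 'C(n, 2).
Proof.
exists (ask_all P (enum (edge n)) set0) => G.
have [-> ->] := ask_allP P (enum (edge n)) set0 G.
split; last by rewrite -cardE card_edge.
by congr (_ \in P); apply/setP=> x; rewrite !inE mem_enum.
Qed.

Lemma decidable_within_ex n (P : {set graph n}) :
  exists k, `[< decidable_within P k >].
Proof. by exists 'C(n, 2); apply/asboolP/decidable_within_bin. Qed.

Definition complexity n (P : {set graph n}) : nat :=
  ex_minn (decidable_within_ex P).

Definition evasive n (P : {set graph n}) : Prop := complexity P = 'C(n, 2).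

(* Integer-valued, since the complex whose only face is the empty graph has
   dimension -1.  Meaningful for nonempty P only. *)
Definition complex_dim n (P : {set graph n}) : int :=
  ((\max_(G in P) #|G|)%:Z - 1)%R.

(* Main.v *)
(* The relabellings of the 2p vertices, seen as two copies of F_p, contain the
   group generated by the translations of the two copies (a p-group) and by a
   map g, normalising it, which exchanges the copies and whose square doubles
   both.  The order complex of the nonempty faces of a nonevasive complex is
   acyclic over F_p: asking for e splits the complex into the link and the
   deletion of e.  By Smith theory the faces fixed by the translations still
   form an acyclic poset, and by the Lefschetz formula g fixes one of them.  The
   resulting nonempty invariant graph contains either all p^2 edges between the
   two copies or, for some d <> 0, the 4p edges {x, x + d} and {x, x + 2d} of
   both copies; these are distinct as p > 3. *)
Require Import Defs.
From HB Require Import structures.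
From mathcomp Require Import all_boot all_order all_fingroup all_algebra.
From mathcomp Require Import zify boolp.

Set Implicit Arguments.
Unset Strict Implicit.
Unset Printing Implicit Defensive.

Import GRing.Theory Num.Theory.
Local Open Scope ring_scope.

(** * Linear algebra and free orbits of prime order *)

Lemma memv_cap_ker (K : fieldType) (V W : vectType K) (f : 'Hom(V, W))
    (A : {vspace V}) v :
  (v \in (A :&: lker f)%VS) = (v \in A) && (f v == 0).
Proof. by rewrite memv_cap memv_ker. Qed.

(* The homology of a [d]-stable [U] has dimension [dim U - 2 dim d(U)], so this
   says that the kernel and the image of [rho] on an exact [A] have homologies of
   the same dimension (the connecting isomorphism, without gradings). *)
Lemma rank_kernel_image (K : fieldType) (V : vectType K) (d rho : 'End(V))
    (A : {vspace V}) :
  {in A, forall v, d v \in A} -> {in A, forall v, rho v \in A} ->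
  {in A, forall v, d (d v) = 0} -> {in A, forall v, d (rho v) = rho (d v)} ->
  (A :&: lker d <= d @: A)%VS ->
  (\dim (A :&: lker rho) + 2 * \dim (d @: (rho @: A)) =
   \dim (rho @: A) + 2 * \dim (d @: (A :&: lker rho)))%N.
Proof.
move=> dA rhoA dd comm kerA.
have exactE : (A :&: lker d = d @: A)%VS.
  apply/eqP; rewrite eqEsubv kerA; apply/subvP=> _ /memv_imgP[v vA ->].
  by rewrite memv_cap_ker dA // dd ?eqxx.
have capE : (d @: A :&: lker rho = (A :&: lker rho) :&: lker d)%VS.
  by rewrite -exactE -!capvA [(lker d :&: _)%VS]capvC.
have imE : (rho @: (d @: A) = d @: (rho @: A))%VS.
  by rewrite -!limg_comp; apply: eq_in_limg => v vA; rewrite !comp_lfunE comm.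
have e1 := limg_ker_dim rho A; have e2 := limg_ker_dim d A.
have e3 := limg_ker_dim rho (d @: A)%VS.
have e4 := limg_ker_dim d (A :&: lker rho)%VS.
by rewrite exactE in e2; rewrite capE imE in e3; lia.
Qed.

Lemma inj_stable (T : finType) (f : T -> T) (X : {set T}) :
  injective f -> {in X, forall x, f x \in X} -> forall x, (f x \in X) = (x \in X).
Proof.
move=> f_inj fX x; suff fXE : f @: X = X by rewrite -{1}fXE mem_imset.
apply/eqP; rewrite eqEcard card_imset // leqnn andbT.
by apply/subsetP=> _ /imsetP[y yX ->]; apply: fX.
Qed.

(* [w] keeps the value of [v] at the root of each free orbit only. *)
Lemma free_orbit_sum (I : finType) (S : I -> I) p (R : nmodType) (v : I -> R) :
  prime p -> (forall c, iter p S c = c) -> (forall c, v (S c) = v c) ->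
  (forall c, S c = c -> v c = 0) ->
  exists2 w : I -> R, forall c, v c = 0 -> w c = 0 &
    forall c, v c = \sum_(i < p) w (iter i S c).
Proof.
move=> p_pr Sp vS v0; have p0 := prime_gt0 p_pr.
have S_inj : injective S.
  by move=> x y Sxy; rewrite -[x]Sp -[y]Sp -(prednK p0) !iterSr Sxy.
have viter n c : v (iter n S c) = v c by elim: n => //= n <-.
exists (fun c => if froot S c == c then v c else 0) => [c -> | c].
  exact: if_same.
have [vc | vc] := eqVneq (v c) 0.
  by rewrite vc big1 // => i _; rewrite viter vc if_same.
have rootS n : froot S (iter n S c) = froot S c.
  apply/esym/eqP; rewrite root_connect; last exact: fconnect_sym.
  exact: fconnect_iter.
have iter_injS n : injective (iter n S).
  by elim: n => [|n IHn] x y //= /S_inj/IHn.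
(* If $0 < m < p$ were a period, Bezout for $m$ and $p$ would show that [S] fixes [c], against
   [v c != 0]. *)
have period n m : iter (n + m) S c = iter n S c -> (m < p)%N -> m = 0%N.
  rewrite iterD => /iter_injS cm mp.
  apply/eqP/negPn/negP => m0; case/eqP: vc; apply: v0.
  have m_gt0 : (0 < m)%N by rewrite lt0n.
  have : coprime m p by rewrite coprime_sym prime_coprime // gtnNdvd.
  rewrite /coprime; case: (egcdnP p m_gt0) => km kn E _ /eqP gcd1.
  have : iter (km * m) S c = c by rewrite iterM iter_fix.
  by rewrite E gcd1 addn1 iterS iterM (iter_fix kn (Sp c)).
have iter_mod n : iter n S c = iter (n %% p) S c.
  by rewrite {1}(divn_eq n p) addnC iterD iterM (iter_fix _ (Sp c)).
have croot : fconnect S c (froot S c) by apply: connect_root.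
have kp : (findex S c (froot S c) %% p < p)%N by rewrite ltn_mod.
have rootE : iter (Ordinal kp) S c = froot S c by rewrite /= -iter_mod iter_findex.
(* The root occurs exactly once among the $p$ iterates, so a single term survives. *)
rewrite (bigD1 (Ordinal kp)) //= rootE big1 ?addr0 => [|i ik].
  by rewrite -rootE rootS rootE eqxx -rootE viter.
rewrite rootS -rootE; case: eqP => // Ei; case/negP: ik; apply/eqP/val_inj.
set k := Ordinal kp in Ei *; have [ik | /ltnW ki] := leqP i k.
  have ki := subnKC ik; apply/eqP; rewrite eqn_leq ik /= -subn_eq0.
  by apply/eqP; apply: (period i); rewrite ?ki // (leq_ltn_trans (leq_subr _ _)).
have ik := subnKC ki; apply/eqP; rewrite eqn_leq ki andbT -subn_eq0.
apply/eqP; apply: (period k); first by rewrite ik Ei.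
exact: leq_ltn_trans (leq_subr _ _) (ltn_ord i).
Qed.

(** * Order complexes *)

Section OrderComplex.

Variables (T : finType) (lt : rel T) (F : fieldType).
Hypotheses (lt_irr : irreflexive lt) (lt_trans : transitive lt).

Local Notation chainfun := {ffun {set T} -> F^o}.
Implicit Types (X Y : {set T}) (b c : {set T}) (v w : chainfun) (x y z : T).

Definition comparable x y := lt x y || lt y x.

Definition chain X c :=
  (c \subset X) && [forall x in c, forall y in c, (x != y) ==> comparable x y].

Lemma chainP X c :
  reflect (c \subset X /\ {in c &, forall x y, x != y -> comparable x y})
          (chain X c).
Proof.
apply: (iffP andP) => [] [cX cc]; split=> //.
  by move=> x y xc yc; move/forall_inP/(_ x xc)/forall_inP/(_ y yc)/implyP: cc.
by apply/forall_inP=> x xc; apply/forall_inP=> y yc; apply/implyP; apply: cc.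
Qed.

Lemma chain_sub X b c : b \subset c -> chain X c -> chain X b.
Proof.
move=> bc /chainP[cX cc]; apply/chainP; split; first exact: subset_trans cX.
by move=> x y /(subsetP bc) xc /(subsetP bc) yc; apply: cc.
Qed.

Lemma chainU1 X x c :
  chain X c -> x \in X -> {in c, forall y, x != y -> comparable x y} ->
  chain X (x |: c).
Proof.
move=> /chainP[cX cc] xX xc; apply/chainP; split.
  by rewrite subUset sub1set xX.
move=> y z /setU1P[-> | yc] /setU1P[-> | zc]; rewrite ?eqxx //.
- exact: xc.
- by rewrite /comparable orbC eq_sym; apply: xc.
- exact: cc.
Qed.

(* Chains may be empty, so homology is reduced.  The sign is given by the rank
   of [x] in the chain [x |: b]; the formula is used on functions supported on
   chains only. *)
Definition bd_fun v : chainfun :=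
  [ffun b : {set T} => \sum_(x | x \notin b)
     (-1) ^+ #|[set y in b | lt y x]| * v (x |: b)].

Fact bd_is_linear : linear bd_fun.
Proof.
move=> a u v; apply/ffunP=> b; rewrite !ffunE scaler_sumr -big_split.
apply: eq_bigr => x _; rewrite !ffunE mulrDr; congr (_ + _).
exact: mulrCA.
Qed.
HB.instance Definition _ :=
  GRing.isLinear.Build F chainfun chainfun _ bd_fun bd_is_linear.

Definition bd : 'End(chainfun) := linfun bd_fun.

Lemma bdE v b :
  bd v b =
  \sum_(x | x \notin b) (-1) ^+ #|[set y in b | lt y x]| * v (x |: b).
Proof. by rewrite lfunE ffunE. Qed.

Definition off_chains X v : chainfun :=
  [ffun c : {set T} => if chain X c then 0 else v c].

Fact off_chains_is_linear X : linear (off_chains X).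
Proof.
move=> a u v; apply/ffunP=> b; rewrite !ffunE.
by case: ifP => // _; rewrite scaler0 addr0.
Qed.
HB.instance Definition _ X :=
  GRing.isLinear.Build F chainfun chainfun _ (off_chains X)
    (off_chains_is_linear X).

(** A kernel in one common ambient space, so that such spaces can be intersected and compared in
    dimension. *)
Definition chains X : {vspace chainfun} := lker (linfun (off_chains X)).

Lemma chainsP X v :
  reflect (forall c, ~~ chain X c -> v c = 0) (v \in chains X).
Proof.
rewrite memv_ker lfunE; apply: (iffP eqP) => [v0 c cX | v0].
  by have /ffunP/(_ c) := v0; rewrite !ffunE (negPf cX).
by apply/ffunP=> c; rewrite !ffunE; case: ifP => // /negbT/v0.
Qed.

Lemma chainsS X Y : X \subset Y -> (chains X <= chains Y)%VS.
Proof.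
move=> XY; apply/subvP=> v /chainsP v0; apply/chainsP=> c cY; apply: v0.
apply: contra cY => /andP[cX cc]; apply/andP; split=> //.
exact: subset_trans XY.
Qed.

Lemma bd_chains X v : v \in chains X -> bd v \in chains X.
Proof.
move/chainsP=> v0; apply/chainsP=> c cX; rewrite bdE big1 // => x _.
rewrite v0 ?mulr0 //; apply: contra cX; apply: chain_sub; exact: subsetUr.
Qed.

Lemma card_filter_setU1 (p : pred T) x b : x \notin b ->
  #|[set z in x |: b | p z]| = (p x + #|[set z in b | p z]|)%N.
Proof.
move=> xb; rewrite -!sum1_card big_mkcond (bigD1 x) //= !inE eqxx /=.
rewrite [in RHS]big_mkcond [in RHS](bigD1 x) //= inE (negPf xb) add0n.
congr (_ + _)%N.
by apply: eq_bigr => y yx; rewrite !inE (negPf yx).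
Qed.

Lemma card_below_setU1 x y b : x \notin b ->
  #|[set z in x |: b | lt z y]| = (lt x y + #|[set z in b | lt z y]|)%N.
Proof. exact: (card_filter_setU1 (lt^~ y)). Qed.

Lemma ltN x y : lt x y -> lt y x = false.
Proof. by move=> xy; apply/negP=> /(lt_trans xy); rewrite lt_irr. Qed.

(** The double sum runs over ordered pairs. Swapping a comparable pair flips the sign, since only
    the smaller element counts in the rank of the larger; incomparable pairs contribute nothing, as
    [v] lives on chains. *)
Lemma bdK X v : v \in chains X -> bd (bd v) = 0.
Proof.
move/chainsP=> v0; apply/ffunP=> b; rewrite bdE [RHS]ffunE.
pose a x y : F := (-1) ^+ #|[set z in b | lt z x]| *
   ((-1) ^+ #|[set z in x |: b | lt z y]| * v (y |: (x |: b))).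
pose D x y := [&& x \notin b, y \notin b & x != y].
transitivity (\sum_x \sum_(y | D x y) a x y).
  rewrite big_mkcond; apply: eq_bigr => x _; rewrite /D; case: ifP => xb /=.
    rewrite bdE big_distrr /=; apply: eq_bigl => y.
    by rewrite !inE negb_or andbC eq_sym.
  by rewrite big_pred0.
have aC x y : D x y -> lt x y -> a x y = - a y x.
  case/and3P=> xb yb _ xy; rewrite /a setUCA !card_below_setU1 //.
  rewrite xy (ltN xy) !exprD expr1 expr0 !mulN1r mul1r !mulNr mulrN.
  by congr (- _); rewrite mulrCA.
have a0 x y : D x y -> ~~ comparable x y -> a x y = 0.
  case/and3P=> _ _ xy cxy; rewrite /a v0 ?mulr0 //.
  apply: contra cxy => /chainP[_]; apply; rewrite ?inE ?eqxx ?orbT //.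
rewrite pair_big_dep (bigID (fun z : T * T => lt z.1 z.2)) /=.
rewrite (bigID (fun z : T * T => lt z.2 z.1)
               (fun z : T * T => D z.1 z.2 && ~~ lt z.1 z.2)) /=.
rewrite [X in _ + (_ + X)]big1 ?addr0; last first.
  by move=> [x y] /= /andP[/andP[Dxy xy] yx]; apply: a0; rewrite // negb_or xy.
have swap_inj : injective (fun z : T * T => (z.2, z.1)).
  by case=> ? ? [? ?] [-> ->].
rewrite [X in _ + X](reindex_inj swap_inj) /=; apply/eqP.
rewrite addr_eq0 -sumrN; apply/eqP/eq_big => [[x y] | [x y] /andP[Dxy xy]] /=.
  rewrite /D eq_sym; case: (boolP (lt x y)) => [/ltN -> | _].
    by rewrite !andbT andbCA.
  by rewrite !andbF.
exact: aC.
Qed.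

(** Vanishing of reduced homology in all degrees at once. The empty chain counts, so the empty poset
    is not acyclic. *)
Definition acyclic X :=
  forall v, v \in chains X -> bd v = 0 -> exists2 w, w \in chains X & bd w = v.

(** * Links, deletions and cones *)

Definition link X x := [set y in X | comparable x y].

Definition parity v : chainfun := [ffun c : {set T} => (-1) ^+ #|c| * v c].

(** The cone over [v] with apex [x]. The sign counts the elements above [x], complementing [bd],
    which counts those below. *)
Definition join x v : chainfun :=
  [ffun c : {set T} =>
     if x \in c then (-1) ^+ #|[set y in c | lt x y]| * v (c :\ x) else 0].

Lemma parityK : involutive parity.
Proof.
by move=> v; apply/ffunP=> c; rewrite !ffunE mulrA -expr2 sqrr_sign mul1r.
Qed.

Lemma parityN v : parity (- v) = - parity v.
Proof. by apply/ffunP=> c; rewrite !ffunE mulrN. Qed.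

Lemma parity_chains X v : v \in chains X -> parity v \in chains X.
Proof.
by move/chainsP=> v0; apply/chainsP=> c cX; rewrite ffunE v0 ?mulr0.
Qed.

Lemma bd_parity v : bd (parity v) = - parity (bd v).
Proof.
apply/ffunP=> b; rewrite bdE !ffunE bdE big_distrr -sumrN /=.
apply: eq_bigr => x xb; rewrite !ffunE cardsU1 xb exprS mulN1r mulNr mulrN.
by rewrite mulrCA.
Qed.

Lemma link_sub X x : link X x \subset X :\ x.
Proof.
apply/subsetP=> y; rewrite !inE => /andP[-> xy]; rewrite andbT.
by apply: contraTneq xy => ->; rewrite /comparable lt_irr.
Qed.

Lemma notin_chain X x c : chain (X :\ x) c -> x \notin c.
Proof. by case/chainP=> /subsetP cX _; apply/negP=> /cX; rewrite !inE eqxx. Qed.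

Lemma join_chains X x v :
  x \in X -> v \in chains (link X x) -> join x v \in chains X.
Proof.
move=> xX /chainsP v0; apply/chainsP=> c cX; rewrite ffunE; case: ifP => // xc.
rewrite v0 ?mulr0 //; apply: contra cX => ccx; rewrite -(setD1K xc).
have [/subsetP cl cc] := chainP _ _ ccx.
apply: chainU1 => // [|y /cl]; last by rewrite inE => /andP[].
apply/chainP; split=> //; apply/subsetP=> y /cl.
by rewrite inE => /andP[].
Qed.

(** [a] collects the chains avoiding [x]; [b] the chains through [x], with [x] removed and the sign
    of [join] undone. *)
Lemma chainfun_split X x v : x \in X -> v \in chains X ->
  exists a, exists2 b, a \in chains (X :\ x) /\ b \in chains (link X x) &
    v = a + join x b.
Proof.
move=> xX /chainsP v0.
exists [ffun c : {set T} => if x \in c then 0 else v c].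
exists [ffun c : {set T} =>
  if x \in c then 0 else (-1) ^+ #|[set y in c | lt x y]| * v (x |: c)].
  split; apply/chainsP=> c; rewrite ffunE; case: ifPn => // xc.
    move=> cX; apply: v0; apply: contra cX => /chainP[cX cc].
    by apply/chainP; split=> //; rewrite subsetD1 cX.
  move=> cX; rewrite v0 ?mulr0 //; apply: contra cX => /chainP[cX cc].
  apply/chainP; split=> [|y z yc zc]; last by apply: cc; rewrite !inE ?yc ?zc orbT.
  apply/subsetP=> y yc; rewrite inE (subsetP cX) ?inE ?yc ?orbT //.
  apply: cc; rewrite ?inE ?eqxx ?yc ?orbT //.
  by apply: contraNneq xc => ->.
apply/ffunP=> c; rewrite !ffunE; case: ifPn => xc; last by rewrite addr0.
rewrite add0r !inE eqxx /= setD1K //.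
have -> : [set y in c | lt x y] = [set y in c :\ x | lt x y].
  by apply/setP=> y; rewrite !inE; case: eqVneq => [->|]; rewrite ?lt_irr ?andbF.
by rewrite mulrA -expr2 sqrr_sign mul1r.
Qed.

Lemma join_eq0 X x (a b : chainfun) :
    a \in chains (X :\ x) -> b \in chains (link X x) ->
  a + join x b = 0 -> a = 0 /\ b = 0.
Proof.
move=> aX bX eq0; suff b0 : b = 0.
  split=> //; move: eq0; rewrite b0 => /ffunP e; apply/ffunP=> c.
  by move: (e c); rewrite !ffunE mulr0 if_same addr0.
apply/ffunP=> c; rewrite [RHS]ffunE; case: (boolP (x \in c)) => xc.
  move/chainsP: bX; apply; apply/negP.
  case/andP=> /subset_trans/(_ (link_sub X x))/subsetP/(_ x xc).
  by rewrite !inE eqxx.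
have := congr1 (fun f : chainfun => f (x |: c)) eq0.
rewrite !ffunE setU11 setU1K //; move/chainsP: aX => ->; last first.
  by apply/negP=> /notin_chain; rewrite setU11.
by move/eqP; rewrite add0r mulf_eq0 signr_eq0 => /eqP.
Qed.

(** When the apex is dropped, the exponent counts the elements above and below [x], which on the
    link is all of them. When another [y] is dropped, whether [x] lies below [y] enters both signs
    and cancels. *)
Lemma bd_join X x v : v \in chains (link X x) ->
  bd (join x v) = join x (bd v) + parity v.
Proof.
move=> vX; have vx c : x \in c -> v c = 0.
  move=> xc; move/chainsP: vX; apply; apply/negP.
  case/andP=> /subset_trans/(_ (link_sub X x))/subsetP/(_ x xc).
  by rewrite !inE eqxx.
apply/ffunP=> c; rewrite bdE !ffunE bdE; case: ifPn => xc.
  rewrite (vx c) // mulr0 addr0 big_distrr /= [RHS](bigD1 x) ?inE ?eqxx //=.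
  rewrite (vx (x |: _)) ?setU11 // !mulr0 add0r.
  apply: eq_big => [y | y yc].
    by rewrite !inE; case: eqVneq => [->|]; rewrite ?xc //= andbT.
  have yx : y != x by apply: contraNneq yc => ->.
  rewrite ffunE inE xc orbT (card_filter_setU1 (lt x)) //.
  rewrite -{1}(setD1K xc) card_below_setU1 ?setD11 // setDUl.
  have -> : [set y] :\ x = [set y].
    by apply/setP=> z; rewrite !inE andbC; case: (z =P y) => // ->; rewrite yx.
  rewrite !exprD [in RHS]mulrA [LHS]mulrA; congr (_ * _).
  by rewrite mulrACA -expr2 sqrr_sign mul1r mulrC.
rewrite add0r (bigD1 x) //= big1 ?addr0 => [|y /andP[yc yx]]; last first.
  by rewrite ffunE !inE (negPf xc) eq_sym (negPf yx) mulr0.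
rewrite ffunE setU11 setU1K // (card_filter_setU1 (lt x)) // lt_irr add0n.
case: (boolP (chain (link X x) c)) => [/chainP[cl _] | cX]; last first.
  by move/chainsP: vX => v0; rewrite v0 ?mulr0.
rewrite mulrA -exprD; congr ((-1) ^+ _ * _).
rewrite -(cardsID [set y | lt y x] c) -setIdE; congr (_ + #|pred_of_set _|)%N.
apply/setP=> y; rewrite !inE; case: (boolP (y \in c)) => //= yc.
  move/subsetP/(_ y yc): cl; rewrite inE /comparable => /andP[_].
  by case/orP=> xy; rewrite ?xy (ltN xy).
by rewrite andbF.
Qed.

(* Writing a cycle as [a + join x b] with [a] off [x] and [b] on the link, the
   cycle condition reads [bd b = 0] and [bd a = - parity b]. *)
Lemma acyclic_cone X x : x \in X -> X :\ x \subset link X x -> acyclic X.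
Proof.
move=> xX Xl v vX dv0.
have linkE : link X x = X :\ x by apply/eqP; rewrite eqEsubset link_sub.
have [a [b [aX bX] vE]] := chainfun_split xX vX.
have [] := @join_eq0 X x (bd a + parity b) (bd b) _ (bd_chains bX).
- by rewrite rpredD ?bd_chains // -linkE parity_chains.
- by rewrite -addrA [parity b + _]addrC -(bd_join bX) -linearD -vE.
(* [a] lives on the link and can be coned off; the relation [ab] turns the boundary of this cone
   into [a + join x b]. *)
move=> ab db0; exists (join x (parity a)).
  by rewrite join_chains // linkE parity_chains.
rewrite (@bd_join X) ?linkE ?parity_chains // parityK bd_parity vE addrC.
congr (_ + join x _); move/eqP: ab; rewrite addr_eq0 => /eqP->.
by rewrite parityN opprK parityK.
Qed.

(** A Mayer-Vietoris argument by hand: [b] is the boundary of some [c] on the link; then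
    [a - parity c] is a cycle of the deletion, hence the boundary of some [w], and [w + join x c]
    has boundary [v]. *)
Lemma acyclic_setD1 X x : x \in X ->
  acyclic (X :\ x) -> acyclic (link X x) -> acyclic X.
Proof.
move=> xX acX acl v vX dv0.
have [a [b [aX bX] vE]] := chainfun_split xX vX.
have [] := @join_eq0 X x (bd a + parity b) (bd b) _ (bd_chains bX).
- rewrite rpredD ?bd_chains // (subvP (chainsS (link_sub X x))) //.
  exact: parity_chains.
- by rewrite -addrA [parity b + _]addrC -(bd_join bX) -linearD -vE.
move=> ab /acl[//|c cX cb].
have [] := acX (a - parity c).
- rewrite rpredB // (subvP (chainsS (link_sub X x))) //.
  exact: parity_chains.
- by rewrite linearB /= bd_parity cb opprK.
move=> w wX wE; exists (w + join x c).
  by rewrite rpredD ?join_chains // (subvP (chainsS (subD1set X x))).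
by rewrite linearD /= wE (bd_join cX) cb addrCA subrK addrC -vE.
Qed.

(** * Order automorphisms and their fixed points *)

Definition pullback (h : T -> T) v : chainfun :=
  [ffun c : {set T} => v (h @: c)].

Fact pullback_is_linear h : linear (pullback h).
Proof. by move=> a u v; apply/ffunP=> b; rewrite !ffunE. Qed.
HB.instance Definition _ h :=
  GRing.isLinear.Build F chainfun chainfun _ (pullback h) (pullback_is_linear h).

Section Automorphism.

Variables (X : {set T}) (h : T -> T).
Hypotheses (h_inj : injective h) (h_lt : {mono h : x y / lt x y}).
Hypothesis (hX : forall x, (h x \in X) = (x \in X)).

Lemma chain_imset c : chain X (h @: c) = chain X c.
Proof.
apply/chainP/chainP=> [] [/subsetP cX cc]; split.
- by apply/subsetP=> x xc; rewrite -hX cX // imset_f.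
- move=> x y xc yc xy; have := cc (h x) (h y).
  by rewrite !imset_f // inj_eq // /comparable !h_lt; apply.
- by apply/subsetP=> _ /imsetP[x xc ->]; rewrite hX cX.
- move=> _ _ /imsetP[x xc ->] /imsetP[y yc ->].
  by rewrite inj_eq // /comparable !h_lt; apply: cc.
Qed.

Lemma pullback_chains v : v \in chains X -> pullback h v \in chains X.
Proof.
move=> /chainsP v0; apply/chainsP=> c cX.
by rewrite ffunE v0 // chain_imset.
Qed.

Lemma bd_pullback v : bd (pullback h v) = pullback h (bd v).
Proof.
apply/ffunP=> b; rewrite [RHS]ffunE !bdE [RHS](reindex_inj h_inj) /=.
apply: eq_big => [x | x xb]; first by rewrite mem_imset.
rewrite ffunE imsetU1; congr ((-1) ^+ _ * _).
rewrite -(card_imset _ h_inj); congr #|pred_of_set _|.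
apply/setP=> y; rewrite inE; apply/imsetP/andP=> [[z] | [/imsetP[z zb ->]]].
  by rewrite inE => /andP[zb zx] ->; rewrite imset_f ?h_lt.
by rewrite h_lt => zx; exists z; rewrite // inE zb.
Qed.

(** Iterating $x < h(x)$ around the finite orbit of $x$ would give $x < x$. *)
Lemma lt_orbit x : lt x (h x) = false.
Proof.
apply/negP=> xhx; have xiter n : lt x (iter n.+1 h x).
  elim: n => [//|n IHn] /=; apply: lt_trans xhx _; rewrite h_lt; exact: IHn.
have := xiter (fingraph.order h x).-1.
by rewrite prednK ?order_gt0 // iter_order // lt_irr.
Qed.

Lemma gt_orbit x : lt (h x) x = false.
Proof.
apply/negP=> hxx; have iterx n : lt (iter n.+1 h x) x.
  elim: n => [//|n IHn] /=; apply: lt_trans hxx; rewrite h_lt; exact: IHn.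
have := iterx (fingraph.order h x).-1.
by rewrite prednK ?order_gt0 // iter_order // lt_irr.
Qed.

Lemma chain_fixed c : chain X c -> h @: c = c -> {in c, forall x, h x = x}.
Proof.
move=> /chainP[_ cc] hc x xc; apply/esym/eqP/negPn/negP=> hx.
have hxc : h x \in c by rewrite -hc imset_f.
by have := cc x (h x) xc hxc hx; rewrite /comparable lt_orbit gt_orbit.
Qed.

Definition fixed := [set x in X | h x == x].

(** An element is never comparable with its image, so a chain mapped to itself is fixed pointwise.
    Working with order complexes thus makes the invariant simplices those of the fixed subposet. *)
Lemma chain_fixedE c : chain fixed c = chain X c && (h @: c == c).
Proof.
apply/idP/andP=> [/chainP[/subsetP cX cc] | [cX /eqP hc]].
  split.
    apply/chainP; split=> //; apply/subsetP=> x /cX.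
    by rewrite inE => /andP[].
  apply/eqP; rewrite -[RHS]imset_id; apply: eq_in_imset => x /cX.
  by rewrite inE => /andP[_ /eqP].
have fx := chain_fixed cX hc; case/chainP: cX => /subsetP cX cc.
apply/chainP; split=> //; apply/subsetP=> x xc.
by rewrite inE cX // fx ?eqxx.
Qed.

(** * Smith theory *)

Section Smith.

Variable p : nat.
Hypotheses (p_prime : prime p) (pF : p \in [pchar F]).
Hypothesis (hp : forall x, iter p h x = x).

Local Notation S := (fun c : {set T} => h @: c).
Local Notation A := (chains X).
Local Notation G := (chains fixed).

Lemma iter_imset n c : iter n S c = iter n h @: c.
Proof.
elim: n => [|n IHn] /=; first by rewrite imset_id.
by rewrite IHn -imset_comp.
Qed.

Lemma iter_imset_p c : iter p S c = c.
Proof. by rewrite iter_imset -[RHS]imset_id; apply: eq_imset. Qed.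

Lemma imset_h_inj : injective S.
Proof. exact: imset_inj. Qed.

Definition norm_fun v : chainfun :=
  [ffun c : {set T} => \sum_(i < p) v (iter i S c)].

Fact norm_is_linear : linear norm_fun.
Proof.
move=> a u v; apply/ffunP=> b; rewrite !ffunE scaler_sumr -big_split.
by apply: eq_bigr => i _; rewrite !ffunE.
Qed.
HB.instance Definition _ :=
  GRing.isLinear.Build F chainfun chainfun _ norm_fun norm_is_linear.

(** Together with [norm], these are the group ring elements $h - 1$ and $1 + h + \dots + h^{p-1}$,
    whose products vanish. *)
Definition tau : 'End(chainfun) := (linfun (pullback h) - \1)%VF.
Definition norm : 'End(chainfun) := linfun norm_fun.

Lemma tau_pullback v : tau v = pullback h v - v.
Proof. by rewrite add_lfunE opp_lfunE id_lfunE lfunE. Qed.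

Lemma tauE v c : tau v c = v (h @: c) - v c.
Proof. by rewrite tau_pullback !ffunE. Qed.

Lemma normE v c : norm v c = \sum_(i < p) v (iter i S c).
Proof. by rewrite lfunE ffunE. Qed.

Lemma iter_pullbackE n v c : iter n (pullback h) v c = v (iter n S c).
Proof.
by elim: n c => [|n IHn] c //; rewrite iterS ffunE IHn iterSr.
Qed.

Lemma norm_pullback v : norm v = \sum_(i < p) iter i (pullback h) v.
Proof.
apply/ffunP=> c; rewrite normE sum_ffunE.
by apply: eq_bigr => i _; rewrite iter_pullbackE.
Qed.

Lemma tau_chains v : v \in A -> tau v \in A.
Proof.
by move=> vX; rewrite tau_pullback rpredB ?pullback_chains.
Qed.

Lemma norm_chains v : v \in A -> norm v \in A.
Proof.
move=> vX; rewrite norm_pullback rpred_sum // => i _.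
by elim: (i : nat) => //= n; apply: pullback_chains.
Qed.

Lemma bd_tau v : bd (tau v) = tau (bd v).
Proof.
by rewrite !tau_pullback linearB /= bd_pullback.
Qed.

Lemma bd_norm v : bd (norm v) = norm (bd v).
Proof.
rewrite !norm_pullback linear_sum; apply: eq_bigr => i _ /=.
by elim: (i : nat) => //= n IHn; rewrite bd_pullback IHn.
Qed.

Lemma norm_shift v c : norm v (h @: c) = norm v c.
Proof.
rewrite !normE; case: p p_prime iter_imset_p => // n _ Sn.
rewrite big_ord_recr [RHS]big_ord_recl /= addrC -iterSr Sn; congr (_ + _).
by apply: eq_bigr => i _; rewrite -iterSr.
Qed.

Lemma tau_norm v : tau (norm v) = 0.
Proof. by apply/ffunP=> c; rewrite tauE norm_shift subrr ffunE. Qed.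

Lemma norm_tau v : norm (tau v) = 0.
Proof.
apply/ffunP=> c; rewrite normE ffunE; under eq_bigr do rewrite tauE.
rewrite sumrB -normE -(norm_shift v) normE; apply/eqP; rewrite subr_eq0.
by apply/eqP/eq_bigr => i _; rewrite -iterSr.
Qed.

Lemma fixed_chains_sub : (G <= A)%VS.
Proof. by apply/chainsS/subsetP=> x; rewrite inE => /andP[]. Qed.

Lemma tau_fixed v : v \in G -> tau v = 0.
Proof.
move=> vG; apply/ffunP=> c; rewrite tauE ffunE.
have [vGc vA] := (chainsP _ _ vG, chainsP _ _ (subvP fixed_chains_sub _ vG)).
have [cX | cX] := boolP (chain X c); last by rewrite !vA ?subrr ?chain_imset.
have [-> | hc] := eqVneq (h @: c) c; first exact: subrr.
rewrite !vGc ?subrr // chain_fixedE ?chain_imset cX //=.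
by rewrite (inj_eq imset_h_inj).
Qed.

(** At an invariant chain the norm is $p$ times one value, zero in characteristic $p$. *)
Lemma norm_fixed_eq0 v c : h @: c = c -> norm v c = 0.
Proof.
move=> hc; rewrite normE; under eq_bigr do rewrite iter_fix //.
by rewrite sumr_const card_ord -mulr_natl (pcharf0 pF) mul0r.
Qed.

Lemma norm_fixed v : v \in G -> norm v = 0.
Proof.
move=> vG; have vS c : v (h @: c) = v c.
  by apply/eqP; rewrite -subr_eq0 -tauE tau_fixed // ffunE.
have viter n c : v (iter n S c) = v c by elim: n => //= n <-.
apply/ffunP=> c; rewrite normE ffunE; under eq_bigr do rewrite viter.
by rewrite sumr_const card_ord -mulr_natl (pcharf0 pF) mul0r.
Qed.

Lemma capv_fixed_eq0 (U : {vspace chainfun}) :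
  {in U, forall v c, h @: c = c -> v c = 0} -> (U :&: G = 0)%VS.
Proof.
move=> U0; apply/eqP; rewrite -subv0; apply/subvP=> v.
rewrite memv_cap memv0 => /andP[vU /chainsP vG]; apply/eqP/ffunP=> c.
rewrite ffunE; have [hc | hc] := eqVneq (h @: c) c; first exact: U0.
by rewrite vG // chain_fixedE (negPf hc) andbF.
Qed.

(** An invariant function splits into its part [u] on the invariant chains and a rest that vanishes
    there; by [free_orbit_sum] the rest is a norm. *)
Lemma ker_tau : (A :&: lker tau = norm @: A + G)%VS.
Proof.
apply/eqP; rewrite eqEsubv subv_add; apply/and3P; split.
- apply/subvP=> v; rewrite memv_cap_ker => /andP[vA /eqP tv].
  have vS c : v (h @: c) = v c.
    by apply/eqP; rewrite -subr_eq0 -tauE tv ffunE.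
  pose u : chainfun := [ffun c : {set T} => if h @: c == c then v c else 0].
  have uG : u \in G.
    apply/chainsP=> c; rewrite chain_fixedE ffunE; case: (_ == c) => //.
    by rewrite andbT => cX; move/chainsP: vA => ->.
  have [] := @free_orbit_sum _ S p F^o (v - u) p_prime iter_imset_p.
  - by move=> c; rewrite !ffunE vS (inj_eq imset_h_inj).
  - by move=> c hc; rewrite !ffunE hc eqxx subrr.
  move=> w w0 wE; rewrite -(subrK u v); apply: memv_add => //.
  apply/memv_imgP; exists [ffun c => w c].
    apply/chainsP=> c cX; rewrite ffunE w0 // !ffunE.
    by move/chainsP: vA => -> //; rewrite if_same subrr.
  by apply/ffunP=> c; rewrite wE normE; apply: eq_bigr => i _; rewrite ffunE.
- apply/subvP=> _ /memv_imgP[v vA ->].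
  by rewrite memv_cap_ker norm_chains //= tau_norm.
- apply/subvP=> v vG; rewrite memv_cap_ker tau_fixed // eqxx andbT.
  exact: (subvP fixed_chains_sub).
Qed.

Lemma dim_directD (U : {vspace chainfun}) :
  {in U, forall v c, h @: c = c -> v c = 0} ->
  \dim (U + G) = (\dim U + \dim G)%N.
Proof. by move=> U0; apply: dimv_disjoint_sum; apply: capv_fixed_eq0. Qed.

Lemma img_norm_fixed :
  {in (norm @: A)%VS, forall v c, h @: c = c -> v c = 0}.
Proof. by move=> _ /memv_imgP[v _ ->] c; apply: norm_fixed_eq0. Qed.

Lemma img_tau_fixed :
  {in (tau @: A)%VS, forall v c, h @: c = c -> v c = 0}.
Proof. by move=> _ /memv_imgP[v _ ->] c hc; rewrite tauE hc subrr. Qed.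

(** One inclusion is direct; equality follows by counting dimensions, from rank-nullity for [tau]
    and [norm] and from [ker_tau], both sums being direct. *)
Lemma ker_norm : (A :&: lker norm = tau @: A + G)%VS.
Proof.
apply/esym/eqP; rewrite eqEdim subv_add; apply/andP; split;
  first (apply/andP; split).
- apply/subvP=> _ /memv_imgP[u uA ->].
  by rewrite memv_cap_ker tau_chains //= norm_tau.
- apply/subvP=> v vG; rewrite memv_cap_ker norm_fixed // eqxx andbT.
  exact: (subvP fixed_chains_sub).
rewrite dim_directD; last exact: img_tau_fixed.
rewrite -(leq_add2r (\dim (norm @: A))) limg_ker_dim -(limg_ker_dim tau A).
rewrite ker_tau dim_directD; last exact: img_norm_fixed.
by rewrite addnC addnA addnAC.
Qed.

Theorem smith_acyclic : acyclic X -> acyclic fixed.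
Proof.
move=> acX.
have bdG : (bd @: G <= G)%VS.
  by apply/subvP=> _ /memv_imgP[v vG ->]; apply: bd_chains.
(* [bd] maps each summand into itself, so the images still form a direct sum. *)
have dims (f : 'End(chainfun)) : (forall v, v \in A -> f v \in A) ->
    (forall v, bd (f v) = f (bd v)) ->
    {in (f @: A)%VS, forall v c, h @: c = c -> v c = 0} ->
    \dim (bd @: (f @: A + G)) = (\dim (bd @: (f @: A)) + \dim (bd @: G))%N.
  move=> fA bdf f0; rewrite limgD; apply: dimv_disjoint_sum.
  apply/eqP; rewrite -subv0 -(capv_fixed_eq0 f0) capvS //.
  apply/subvP=> _ /memv_imgP[_ /memv_imgP[v vA ->] ->].
  by rewrite bdf memv_img // bd_chains.
have exactA : (A :&: lker bd <= bd @: A)%VS.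
  apply/subvP=> v; rewrite memv_cap_ker => /andP[vA /eqP bdv].
  by have [w wA <-] := acX v vA bdv; apply: memv_img.
have bdA : {in A, forall v, bd v \in A} by move=> v; apply: bd_chains.
have bdbd : {in A, forall v, bd (bd v) = 0} by move=> v; apply: bdK.
(* With [H] for the dimension of homology, the kernel decompositions give
   [H (norm A) + H G = H (tau A)] and [H (tau A) + H G = H (norm A)]. *)
have e1 := rank_kernel_image bdA tau_chains bdbd (fun v _ => bd_tau v) exactA.
have e2 := rank_kernel_image bdA norm_chains bdbd (fun v _ => bd_norm v) exactA.
rewrite ker_tau dim_directD in e1; last exact: img_norm_fixed.
rewrite ker_norm dim_directD in e2; last exact: img_tau_fixed.
rewrite (dims _ norm_chains bd_norm img_norm_fixed) in e1.
rewrite (dims _ tau_chains bd_tau img_tau_fixed) in e2.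
(* Adding the two relations gives $2H(G) = 0$: cycles and boundaries of [G] have equal dimension. *)
have exactG : (bd @: G = G :&: lker bd)%VS.
  apply/eqP; rewrite eqEdim; apply/andP; split.
    apply/subvP=> _ /memv_imgP[v vG ->].
    by rewrite memv_cap_ker bd_chains ?(bdK vG) //=.
  move: e1 e2 (limg_ker_dim bd G).
  move: (\dim (bd @: (norm @: A))) (\dim (bd @: (tau @: A))).
  move: (\dim (norm @: A)) (\dim (tau @: A)).
  move: (\dim (G :&: lker bd)) (\dim (bd @: G)) (\dim G); lia.
move=> v vG bdv.
have : v \in (bd @: G)%VS by rewrite exactG memv_cap_ker vG bdv /=.
by case/memv_imgP=> w wG ->; exists w.
Qed.

End Smith.

(** * The Lefschetz fixed point theorem *)

Section Lefschetz.

Local Notation A := (chains X).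

Definition basis_chain c : chainfun := [ffun b : {set T} => (b == c)%:R].

Lemma basis_chain_chains c : chain X c -> basis_chain c \in A.
Proof.
move=> cX; apply/chainsP=> b bX; rewrite ffunE; case: eqVneq bX => // ->.
by rewrite cX.
Qed.

Lemma chains_sum v :
  v \in A -> v = \sum_(c | chain X c) v c *: basis_chain c.
Proof.
move/chainsP=> v0; apply/ffunP=> b; rewrite sum_ffunE.
under eq_bigr do rewrite !ffunE.
have [bX | bX] := boolP (chain X b).
  rewrite (bigD1 b) //= eqxx big1 => [|c /andP[_ cb]].
    by rewrite addr0; apply/esym/mulr1.
  by rewrite eq_sym (negPf cb); apply: mulr0.
rewrite v0 // big1 // => c cX; case: eqVneq => [bc | _]; last exact: mulr0.
by rewrite bc cX in bX.
Qed.

Definition trace (f : chainfun -> chainfun) : F :=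
  \sum_(c | chain X c) f (basis_chain c) c.

Lemma trace_comp (f g : 'End(chainfun)) :
  {in A, forall v, g v \in A} ->
  trace (f \o g) =
  \sum_(c | chain X c) \sum_(b | chain X b)
     g (basis_chain c) b * f (basis_chain b) c.
Proof.
move=> gA; apply: eq_bigr => c cX /=.
rewrite {1}(chains_sum (gA _ (basis_chain_chains cX))) linear_sum sum_ffunE.
by apply: eq_bigr => b _; rewrite linearZ ffunE.
Qed.

Lemma traceC (f g : 'End(chainfun)) :
  {in A, forall v, f v \in A} -> {in A, forall v, g v \in A} ->
  trace (f \o g) = trace (g \o f).
Proof.
move=> fA gA; rewrite !trace_comp // exchange_big /=.
by apply: eq_bigr => b _; apply: eq_bigr => c _; rewrite mulrC.
Qed.

(** A pseudo-inverse provides a linear section [q] of [bd] over the boundaries; since $1 - q\,bd$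
    sends chains to cycles, $k = q(1 - q\,bd)$ is a contracting homotopy. *)
Lemma acyclic_contraction : acyclic X ->
  exists2 k : 'End(chainfun), {in A, forall v, k v \in A} &
    {in A, forall v, bd (k v) + k (bd v) = v}.
Proof.
move=> acX.
pose pr : 'End(chainfun) := (\1 - linfun (off_chains X))%VF.
have prE v : pr v = v - off_chains X v.
  by rewrite add_lfunE opp_lfunE id_lfunE lfunE.
have prA v : pr v \in A.
  by apply/chainsP=> c cX; rewrite prE !ffunE (negPf cX) subrr.
have prK v : v \in A -> pr v = v.
  move/chainsP=> v0; apply/ffunP=> c; rewrite prE !ffunE.
  by case: ifPn => [_|/v0 ->]; rewrite subr0.
pose q : 'End(chainfun) := (pr \o (bd \o pr)^-1)%VF.
have qA v : q v \in A by rewrite comp_lfunE.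
have qK v : v \in A -> bd v = 0 -> bd (q v) = v.
  move=> vA /(acX v vA)[w wA <-]; rewrite comp_lfunE.
  have wim : bd w \in limg (bd \o pr)%VF.
    by rewrite -[w in bd w]prK // -(comp_lfunE bd pr) memv_img ?memvf.
  by rewrite -[LHS](comp_lfunE bd pr) limg_lfunVK.
have bd0 v : v \in A -> bd (bd v) = 0 by apply: bdK.
have bdA v : v \in A -> bd v \in A by apply: bd_chains.
pose k : 'End(chainfun) := (q \o (\1 - (q \o bd)))%VF.
have kE v : k v = q (v - q (bd v)).
  by rewrite [LHS]comp_lfunE add_lfunE opp_lfunE id_lfunE
    [(q \o bd)%VF v]comp_lfunE.
exists k => v vA; first by rewrite kE.
rewrite !kE bd0 // [q 0]linear0 subr0.
by rewrite qK ?subrK ?rpredB // linearB /= qK ?subrr ?bdA ?bd0.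
Qed.

Fact parity_is_linear : linear parity.
Proof.
move=> a u v; apply/ffunP=> b; rewrite !ffunE mulrDr; congr (_ + _).
exact: mulrCA.
Qed.
HB.instance Definition _ :=
  GRing.isLinear.Build F chainfun chainfun _ parity parity_is_linear.

(* A map commuting with [bd], twisted by [parity], has trace 0 on a contractible
   complex; if [h] fixed no element, only the empty chain would contribute. *)
Theorem lefschetz_fixed_point : acyclic X -> exists2 x, x \in X & h x = x.
Proof.
move=> /acyclic_contraction[k kA kE].
pose phi : 'End(chainfun) := (linfun parity \o linfun (pullback h))%VF.
have phiE v : phi v = parity (pullback h v) by rewrite comp_lfunE !lfunE.
clearbody phi.
have phiA v : v \in A -> phi v \in A.
  by move=> vA; rewrite phiE parity_chains ?pullback_chains.
have bdA v : v \in A -> bd v \in A by apply: bd_chains.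
have bd_phi v : bd (phi v) = - phi (bd v).
  by rewrite !phiE bd_parity bd_pullback.
(* Insert $1 = bd\,k + k\,bd$; cyclicity of the trace and the anticommutation [bd_phi] make the two
   terms cancel. *)
have trace0 : trace phi = 0.
  have -> : trace phi = trace ((phi \o bd)%VF \o k) + trace ((phi \o k)%VF \o bd).
    rewrite -big_split; apply: eq_bigr => c cX /=.
    rewrite -[in LHS](kE _ (basis_chain_chains cX)) linearD ffunE.
    by rewrite !comp_lfunE.
  rewrite [X in _ + X]traceC => [|v vA|v vA]; rewrite ?comp_lfunE ?phiA ?kA ?bdA //.
  rewrite -big_split big1 // => c cX /=.
  by rewrite !comp_lfunE bd_phi ffunE subrr.
have traceE : trace phi = \sum_(c | chain fixed c) (-1) ^+ #|c|.
  rewrite [RHS](eq_bigl _ _ chain_fixedE) [RHS]big_mkcondr.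
  apply: eq_bigr => c cX; rewrite phiE !ffunE.
  by case: eqP => _; rewrite ?mulr1 ?mulr0.
have [fix0 | [x]] := set_0Vmem fixed; last first.
  by rewrite inE => /andP[xX /eqP hx]; exists x.
case/eqP: (oner_neq0 F); rewrite -[RHS]trace0 traceE fix0.
rewrite (bigD1 set0) /=; last by apply/chainP; split=> [|x y]; rewrite ?sub0set ?inE.
rewrite cards0 expr0 big1 ?addr0 // => c /andP[/andP[]].
by rewrite subset0 => ->.
Qed.

End Lefschetz.

End Automorphism.

End OrderComplex.

(** * Nonevasive properties *)

Section NonEvasive.

Variables (n : nat) (F : fieldType) (P : {set graph n}).
Hypothesis P_monotone : monotone P.

Local Notation lt := (fun A B : graph n => A \proper B).
Local Notation acyclic := (@acyclic (graph n) lt F).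

Fact proper_irr : irreflexive lt.
Proof. exact: properxx. Qed.

Fact proper_transitive : transitive lt.
Proof. by move=> B A C; apply: proper_trans. Qed.

(** For disjoint [K] and [S], removing [K] identifies this with the nonempty faces of the link of
    [K] that lie in [S]. Below, [K] holds the edges known to be present and [S] the edges not yet
    asked. *)
Definition face_interval (K S : graph n) : {set graph n} :=
  [set G in P | (K \proper G) && (G \subset K :|: S)].

Lemma in_face_interval (K S G : graph n) :
  (G \in face_interval K S) = [&& G \in P, K \proper G & G \subset K :|: S].
Proof. by rewrite in_set. Qed.

(* Starting from the deletion, the faces containing [e] are added from the
   largest down: when [G] is added its link is a cone with apex [G :\ e].  The
   last one, [e |: K], has for link the face poset of the link of [e]. *)
Lemma acyclic_link_deletion (K S : graph n) (e : edge n) :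
    e \in S -> e \notin K -> e |: K \in P ->
    acyclic (face_interval K (S :\ e)) ->
    acyclic (face_interval (e |: K) (S :\ e)) ->
  acyclic (face_interval K S).
Proof.
move=> eS eK eKP acdel aclink.
set X0 := face_interval K _ in acdel; set X := face_interval K S.
pose W := [set G in X | (e \in G) && (G != e |: K)].
have X0E G : (G \in X0) = (G \in X) && (e \notin G).
  rewrite !in_face_interval -!andbA; congr [&& _, _ & _].
  by rewrite -subsetD1 setDUl [K :\ e](setDidPl _) // disjoint_sym disjoints1.
(* [U] is closed upwards in [W], so below an element of [U] of least size only faces avoiding [e]
   remain. *)
have acU (U : {set graph n}) : U \subset W ->
    (forall G H, G \in U -> H \in W -> G \proper H -> H \in U) ->
    acyclic (X0 :|: U).
  have [m] := ubnP #|U|; elim: m U => // m IHm U /ltnSE-Um UW Uup.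
  have [-> | [G0 G0U]] := set_0Vmem U; first by rewrite setU0.
  have [G GU Gmin] := arg_minnP (fun G : graph n => #|G|) G0U.
  have {}GU : G \in U by [].
  have := subsetP UW _ GU; rewrite in_set => /and3P[GX eG GeK].
  have GX0 : G \notin X0 by rewrite X0E eG andbF.
  apply: (acyclic_setD1 proper_irr proper_transitive (x := G)).
  - by rewrite in_setU GU orbT.
  - have -> : (X0 :|: U) :\ G = X0 :|: (U :\ G).
      rewrite setDUl; congr (_ :|: _); apply/setDidPl.
      by rewrite disjoint_sym disjoints1.
    apply: IHm => [||H H' ].
    + by rewrite [#|U|](cardsD1 G) GU in Um.
    + exact: subset_trans (subD1set _ _) UW.
    + rewrite !in_setD1 => /andP[HG HU] H'W HH'; rewrite (Uup H) // andbT.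
      apply: contraTneq (Gmin H HU) => <-; rewrite -ltnNge.
      exact: proper_card.
  have KG : K \subset G :\ e.
    move: GX; rewrite in_face_interval => /and3P[_ /proper_sub KG _].
    by rewrite subsetD1 KG eK.
  (* The condition [G != e |: K] keeps [G :\ e] strictly larger than [K]. *)
  have mX0 : G :\ e \in X0.
    rewrite X0E in_face_interval !inE eqxx /= andbT properEneq KG andbT.
    move: GX; rewrite in_face_interval => /and3P[GP _ GKS].
    rewrite (P_monotone _ GP) ?subsetDl // (subset_trans (subsetDl _ _)) // !andbT.
    by apply: contraNneq GeK => ->; rewrite setD1K.
  have GeG : G :\ e \proper G by apply: properD1.
  apply: (acyclic_cone proper_irr proper_transitive (x := G :\ e)).
    by rewrite in_set in_setU mX0 /comparable /= GeG orbT.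
  apply/subsetP=> H; rewrite in_setD1 => /andP[HGe Hl].
  rewrite in_set Hl /comparable /=; move: Hl; rewrite in_set in_setU.
  case/andP=> HXU /orP[GH | HG]; first by rewrite (proper_trans GeG GH).
  have eH : e \notin H.
    case/orP: HXU => [|HU]; first by rewrite X0E => /andP[].
    have := Gmin H HU; rewrite leqNgt.
    by rewrite (proper_card HG).
  by rewrite orbC properEneq HGe subsetD1 (proper_sub HG) eH.
have eKX : e |: K \in X.
  rewrite in_face_interval eKP properUr ?sub1set //= setUC setUS ?sub1set //.
apply: (acyclic_setD1 proper_irr proper_transitive eKX).
- have -> : X :\ (e |: K) = X0 :|: W.
    apply/setP=> G; rewrite in_setU X0E in_setD1 [G \in W]in_set.
    case: eqVneq => [-> | _]; first by rewrite !inE eqxx andbF.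
    by case: (G \in X) (e \in G) => [] [].
  by apply: acU.
(* No graph lies strictly between [K] and [e |: K], so only the faces above remain. *)
rewrite (_ : link _ _ _ = face_interval (e |: K) (S :\ e)) //.
apply/setP=> G; rewrite in_set !in_face_interval /comparable /=.
case: (G \in P) => //=.
have -> : (e |: K) :|: (S :\ e) = K :|: S.
  by rewrite setUAC setD1K // setUC.
case: (boolP (e |: K \proper G)) => [eKG | _] /=.
  by rewrite (proper_trans _ eKG) ?andbT // properUr // sub1set.
apply/negP=> /andP[/andP[KG _] GeK].
have := proper_card GeK; rewrite cardsU1 eK ltnS leqNgt.
by rewrite (proper_card KG).
Qed.

(** At a leaf the answer is constant, so the whole interval lies in [P] and is a cone with apex
    [K :|: S]; the strict bound makes [S] nonempty, so the apex exceeds [K]. At a question about an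
    edge of [S], the two branches treat the link and the deletion; any other question has a known
    answer and is skipped. *)
Lemma acyclic_face_interval (t : strategy n) (K S : graph n) :
    [disjoint K & S] -> K \in P ->
    (forall G : graph n, K \subset G -> G \subset K :|: S ->
       answer t G = (G \in P) /\ (questions t G < #|S|)%N) ->
  acyclic (face_interval K S).
Proof.
elim: t K S => [b | e t1 IH1 t0 IH0] K S KS KP tP.
  have S0 : (0 < #|S|)%N by have [] := tP K (subxx _) (subsetUl _ _).
  have bT : b = true by have [] := tP K (subxx _) (subsetUl _ _); rewrite KP.
  have sub_P (G : graph n) : K \subset G -> G \subset K :|: S -> G \in P.
    by move=> KG GS; have [] := tP G KG GS; rewrite /= bT.
  have KKS : K \proper K :|: S.
    rewrite properE subsetUl subUset subxx /=.
    apply: contraL S0 => SK; rewrite -leqNgt leqn0 cards_eq0 -subset0.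
    by rewrite -(disjoint_setI0 KS) subsetI SK subxx.
  apply: (acyclic_cone proper_irr proper_transitive (x := K :|: S)).
    by rewrite in_face_interval KKS subxx sub_P ?subsetUl.
  apply/subsetP=> G; rewrite in_setD1 => /andP[GKS GX].
  rewrite in_set GX /comparable /=; move: GX; rewrite in_face_interval.
  by case/and3P=> _ _ GS; rewrite [X in _ || X]properEneq GKS GS orbT.
have [eK | eK] := boolP (e \in K).
  apply: IH1 => // G KG GS; have [] := tP G KG GS.
  by rewrite /= (subsetP KG) // => -> /ltnW.
have [eS | eS] := boolP (e \in S); last first.
  apply: IH0 => // G KG GS; have [] := tP G KG GS.
  have eG : e \notin G.
    by apply: contra (subsetP GS e) _; rewrite in_setU negb_or eK.
  by rewrite /= (negPf eG) => -> /ltnW.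
have acdel : acyclic (face_interval K (S :\ e)).
  apply: IH0 => // [|G KG]; first exact: disjointWr (subD1set _ _) KS.
  rewrite -[K in K :|: _](setDidPl (_ : [disjoint K & [set e]])); last first.
    by rewrite disjoint_sym disjoints1.
  rewrite -setDUl subsetD1 => /andP[GS eG]; have [] := tP G KG GS.
  by rewrite /= (negPf eG) => ->; rewrite (cardsD1 e S) eS add1n ltnS.
have [eKP | eKP] := boolP (e |: K \in P).
  apply: (acyclic_link_deletion eS eK) => //; apply: IH1 => //.
    rewrite -setI_eq0 setIUl setU_eq0 !setI_eq0 disjoints1 setD11 /=.
    exact: disjointWr (subD1set _ _) KS.
  move=> G; rewrite subUset sub1set => /andP[eG KG].
  have -> : (e |: K) :|: (S :\ e) = K :|: S by rewrite setUAC setD1K // setUC.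
  move=> GS; have [] := tP G KG GS.
  by rewrite /= eG => ->; rewrite (cardsD1 e S) eS add1n ltnS.
(* Here no face of the interval contains [e], so the deletion is everything. *)
suff <- : face_interval K (S :\ e) = face_interval K S by [].
apply/setP=> G; rewrite !in_face_interval.
have [GP | //] := boolP (G \in P); have [KG | //] := boolP (K \proper G).
have eG : e \notin G.
  apply: contra eKP => eG; apply: P_monotone GP.
  by rewrite subUset sub1set eG proper_sub.
rewrite -[K in K :|: (_ :\ _)](setDidPl (_ : [disjoint K & [set e]])).
  by rewrite -setDUl subsetD1 eG andbT.
by rewrite disjoint_sym disjoints1.
Qed.

Lemma acyclic_nonevasive :
  ~ evasive P -> P != set0 -> acyclic (P :\ set0).
Proof.
move=> P_nonev /set0Pn[G0 G0P].
have [k [t tP] kn] : exists2 k, decidable_within P k & (k < 'C(n, 2))%N.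
  have cP : decidable_within P (complexity P).
    by rewrite /complexity; case: ex_minnP => k /asboolP.
  exists (complexity P) => //; rewrite ltn_neqAle; apply/andP; split.
    by apply/eqP.
  rewrite /complexity; case: ex_minnP => k _; apply.
  by apply/asboolP/decidable_within_bin.
have -> : P :\ set0 = face_interval set0 setT.
  apply/setP=> G; rewrite in_setD1 in_face_interval proper0 setUT subsetT andbT.
  by rewrite andbC.
apply: (acyclic_face_interval (t := t)) => [||G _ _].
- by rewrite -setI_eq0 set0I.
- exact: P_monotone (sub0set _) G0P.
have [-> tk] := tP G; split=> //; apply: leq_ltn_trans tk _.
by rewrite cardsT card_edge.
Qed.

End NonEvasive.

(** * Invariant graphs *)

Section Relabelling.

Variable n : nat.
Implicit Types (s t : 'S_n) (G H : graph n).

Fact map_edge_subproof s (e : edge n) : #|s @: val e| == 2.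
Proof. by rewrite card_imset ?(valP e) //; apply: perm_inj. Qed.

Definition map_edge s (e : edge n) : edge n :=
  Sub (s @: val e) (map_edge_subproof s e).

Definition relabel s G : graph n := map_edge s @: G.

Lemma map_edge_inj s : injective (map_edge s).
Proof.
move=> e f /(congr1 val); rewrite !SubK => /imset_inj-/(_ (@perm_inj _ s)).
exact: val_inj.
Qed.

Lemma relabel_inj s : injective (relabel s).
Proof. exact/imset_inj/map_edge_inj. Qed.

Lemma relabel_proper s : {mono relabel s : G H / G \proper H}.
Proof.
have mono_sub G H : (relabel s G \subset relabel s H) = (G \subset H).
  apply/idP/idP=> [sGH |]; last exact: imsetS.
  apply/subsetP=> e eG.
  have := subsetP sGH _ (imset_f (map_edge s) eG).
  by rewrite mem_imset //; apply: map_edge_inj.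
by move=> G H; rewrite !properE !mono_sub.
Qed.

Lemma relabel1 G : relabel 1 G = G.
Proof.
rewrite -[RHS]imset_id; apply: eq_imset => e; apply: val_inj.
rewrite SubK -[RHS]imset_id; apply: eq_imset => i; exact: perm1.
Qed.

Lemma relabelM s t G : relabel (s * t)%g G = relabel t (relabel s G).
Proof.
rewrite /relabel -imset_comp; apply: eq_imset => e; apply: val_inj.
rewrite /= -imset_comp; apply: eq_imset => i; exact: permM.
Qed.

Lemma relabelX s k G : relabel (s ^+ k)%g G = iter k (relabel s) G.
Proof.
by elim: k => [|k IHk]; rewrite ?relabel1 // expgSr relabelM IHk.
Qed.

Lemma adjacent_relabel s G i j :
  adjacent (relabel s G) (s i) (s j) = adjacent G i j.
Proof.
have s_inj : injective (fun A : {set 'I_n} => s @: A).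
  exact/imset_inj/perm_inj.
have sE : s @: [set i; j] = [set s i; s j] by rewrite imsetU1 imset_set1.
apply/exists_inP/exists_inP => [[_ /imsetP[e eG ->]] | [e eG /eqP eE]].
  by rewrite SubK -sE (inj_eq s_inj) => /eqP eE; exists e; rewrite ?eE.
by exists (map_edge s e); rewrite ?imset_f // SubK eE sE.
Qed.

Lemma adjacentC G i j : adjacent G i j = adjacent G j i.
Proof. by rewrite /adjacent setUC. Qed.

Lemma adjacent_ex G : G != set0 -> exists i j, i != j /\ adjacent G i j.
Proof.
case/set0Pn=> e eG; have /cards2P[i [j [ij eE]]] := valP e.
by exists i, j; split=> //; apply/exists_inP; exists e; rewrite ?eE.
Qed.

Lemma card_graph_ge (J : finType) (u v : J -> 'I_n) G :
  (forall x, adjacent G (u x) (v x)) ->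
  injective (fun x => [set u x; v x]) -> (#|J| <= #|G|)%N.
Proof.
move=> Guv uv_inj; rewrite -cardsT -(card_imset _ uv_inj).
rewrite -(card_imset _ (val_inj : injective (val : edge n -> _))).
apply/subset_leq_card/subsetP=> _ /imsetP[x _ ->].
have /exists_inP[e eG /eqP eE] := Guv x.
by apply/imsetP; exists e.
Qed.

Lemma relabel_property (P : {set graph n}) s G :
  graph_property P -> (relabel s G \in P) = (G \in P).
Proof.
move=> P_prop; have rP t H : H \in P -> relabel t H \in P.
  by apply: P_prop; exists t => i j; apply: adjacent_relabel.
apply/idP/idP => [|/rP //]; move/(rP s^-1%g).
by rewrite -relabelM mulgV relabel1.
Qed.

(* The groups allowed here are extensions of [<[s1, s2]>], a [p]-group, by the
   cyclic group that [g] generates modulo it. *)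
Lemma nonevasive_fixed_graph (P : {set graph n}) (p k m : nat) (s1 s2 g : 'S_n) :
    graph_property P -> monotone P -> ~ evasive P -> P != set0 -> prime p ->
    (s1 ^+ p = 1)%g -> (s2 ^+ p = 1)%g -> commute s1 s2 ->
    (g * s1 = s2 ^+ k * g)%g -> (g * s2 = s1 ^+ m * g)%g ->
  exists G, [/\ G \in P, G != set0, relabel s1 G = G, relabel s2 G = G &
                relabel g G = G].
Proof.
move=> P_prop P_mono P_nonev P0 p_pr s1p s2p s12 gs1 gs2.
(* Smith theory for [s1] and [s2] asks for coefficients of characteristic $p$. *)
have ac0 := acyclic_nonevasive (F := 'F_p) P_mono P_nonev P0.
set X0 := P :\ set0 in ac0.
have pF : p \in [pchar 'F_p] by apply: pchar_Fp.
have relabelXp s G : (s ^+ p = 1)%g -> iter p (relabel s) G = G.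
  by move=> sp; rewrite -relabelX sp relabel1.
have X0s s G : (relabel s G \in X0) = (G \in X0).
  rewrite !in_setD1 relabel_property //; congr (~~ _ && _).
  by rewrite -[in RHS](inj_eq (@relabel_inj s)) [relabel s set0]imset0.
have ac1 := smith_acyclic (@proper_irr n) (@proper_transitive n)
  (@relabel_inj s1) (relabel_proper s1) (X0s s1) p_pr pF
  (fun G => relabelXp s1 G s1p) ac0.
set X1 := fixed _ _ in ac1.
have X1E G : (G \in X1) = (G \in X0) && (relabel s1 G == G).
  by rewrite in_set.
(* Commuting with [s1], [s2] acts on the faces fixed by [s1], and Smith theory applies a second
   time. *)
have X1s2 G : (relabel s2 G \in X1) = (G \in X1).
  rewrite !X1E X0s; congr (_ && _).
  by rewrite -relabelM -s12 relabelM (inj_eq (@relabel_inj s2)).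
have ac2 := smith_acyclic (@proper_irr n) (@proper_transitive n)
  (@relabel_inj s2) (relabel_proper s2) X1s2 p_pr pF
  (fun G => relabelXp s2 G s2p) ac1.
set X2 := fixed _ _ in ac2.
have X2E G : (G \in X2) = [&& G \in X0, relabel s1 G == G & relabel s2 G == G].
  by rewrite in_set X1E andbA.
(* The relations move [s1] and [s2] past [g] as powers of [s2] and [s1], which fix [G]. *)
have X2g : {in X2, forall G, relabel g G \in X2}.
  move=> G; rewrite !X2E X0s => /and3P[-> /eqP G1 /eqP G2].
  rewrite -!relabelM gs1 gs2 !relabelM !relabelX.
  by rewrite !iter_fix ?eqxx.
have [G GX2 gG] := lefschetz_fixed_point (@proper_irr n) (@proper_transitive n)
  (@relabel_inj g) (relabel_proper g) (inj_stable (@relabel_inj g) X2g) ac2.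
exists G; move: GX2; rewrite X2E in_setD1.
by case/and3P=> /andP[G0 GP] /eqP-> /eqP->.
Qed.

End Relabelling.

Lemma set2_eq (T : finType) (a b c d : T) :
  [set a; b] = [set c; d] -> (a = c /\ b = d) \/ (a = d /\ b = c).
Proof.
move=> E; have := set21 a b; have := set22 a b; have := set21 c d.
have := set22 c d; rewrite E -{1 2}E.
by do 4!case/set2P=> ?; subst; auto.
Qed.

(** * Permutations of two copies of the prime field *)

Section PrimeDouble.

Variable p : nat.
Hypotheses (p_prime : prime p) (p_gt3 : (3 < p)%N).

Local Notation W := (bool * 'F_p)%type.

Definition shift_half (b : bool) (w : W) : W :=
  (w.1, if w.1 == b then w.2 + 1 else w.2).

(* Its square doubles both halves; a plain swap would only yield 2p edges. *)
Definition swap_double (w : W) : W := (~~ w.1, if w.1 then w.2 else w.2 + w.2).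

Lemma natr_Fp_neq0 m : (0 < m < p)%N -> m%:R != 0 :> 'F_p.
Proof.
case/andP=> m0 mp; rewrite -(dvdn_pcharf (pchar_Fp p_prime)).
by rewrite gtnNdvd.
Qed.

Lemma p_neq4 : p != 4.
Proof. by apply: contraTneq p_prime => ->. Qed.

(** A prime above 3 is at least 5. Multiples up to 4 arise as sums of two of the differences $d$ and
    $2d$. *)
Lemma mulrn_Fp_eq0 (d : 'F_p) m : (0 < m <= 4)%N -> (d *+ m == 0) = (d == 0).
Proof.
move=> m4; rewrite -mulr_natl mulf_eq0 (negPf (natr_Fp_neq0 _)) //.
have := p_neq4; lia.
Qed.

Lemma shift_half_inj b : injective (shift_half b).
Proof.
move=> [b1 x1] [b2 x2] [/= <-]; case: eqP => _ => [/addIr|] -> //.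
Qed.

Lemma swap_double_inj : injective swap_double.
Proof.
move=> [b1 x1] [b2 x2] [/= /negb_inj <-]; case: b1 => [-> //|].
move/eqP; rewrite -!mulr2n -subr_eq0 -mulrnBl mulrn_Fp_eq0 // subr_eq0.
by move/eqP->.
Qed.

Lemma iter_shift_half k b w :
  iter k (shift_half b) w = (w.1, if w.1 == b then w.2 + k%:R else w.2).
Proof.
elim: k => [|k IHk] /=; first by case: w => c x /=; rewrite addr0 if_same.
rewrite IHk /shift_half /=; case: eqP => // _.
by rewrite -addrA natr1.
Qed.

Lemma bij_vertices : exists f : W -> 'I_(2 * p), bijective f.
Proof.
have cW : #|{: W}| = (2 * p)%N by rewrite card_prod card_bool card_Fp.
exists (cast_ord cW \o enum_rank); apply: bij_comp; last exact: enum_rank_bij.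
by apply: inj_card_bij (@cast_ord_inj _ _ cW) _; rewrite !card_ord cW.
Qed.

End PrimeDouble.

(** * Counting the edges of an invariant graph *)

Lemma nonevasive_graph_card_ge (p : nat) (P : {set graph (2 * p)}) :
    prime p -> (3 < p)%N -> graph_property P -> monotone P -> ~ evasive P ->
  P != set0 -> exists2 G, G \in P & (4 * p <= #|G|)%N.
Proof.
move=> p_prime p_gt3 P_property P_monotone P_nonevasive P0.
have [f [f' fK f'K]] := bij_vertices p_prime.
have f_inj := can_inj fK.
pose lift_fun (h : bool * 'F_p -> bool * 'F_p) i := f (h (f' i)).
have lift_inj h : injective h -> injective (lift_fun h).
  by move=> h_inj; apply: inj_comp f_inj (inj_comp h_inj (can_inj f'K)).
pose s b := perm (lift_inj _ (@shift_half_inj p b)).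
pose g := perm (lift_inj _ (swap_double_inj p_prime p_gt3)).
have sE b w : s b (f w) = f (shift_half b w) by rewrite permE /lift_fun fK.
have gE w : g (f w) = f (swap_double w) by rewrite permE /lift_fun fK.
have sXE b k w : (s b ^+ k)%g (f w) = f (iter k (shift_half b) w).
  by rewrite permX; elim: k => //= k ->.
have eq_on (t u : 'S_(2 * p)) : (forall w, t (f w) = u (f w)) -> t = u.
  by move=> tu; apply/permP=> i; rewrite -[i]f'K.
have pF0 : p%:R = 0 :> 'F_p by apply: pcharf0; apply: pchar_Fp.
have sp b : (s b ^+ p = 1)%g.
  apply: eq_on => -[c x]; rewrite sXE perm1 iter_shift_half /= pF0 addr0.
  by rewrite if_same.
have sC : commute (s true) (s false).
  by apply: eq_on => -[[] x]; rewrite !permM !sE.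
(* The inverse of 2 modulo $p$: [g] doubles on the way from copy [false] to copy [true], so a shift
   by [k] before [g] becomes a shift by 1 after it. *)
pose k := p.+1./2.
have kk : k%:R + k%:R = 1 :> 'F_p.
  rewrite -natrD addnn even_halfK /=; first by rewrite -natr1 pF0 add0r.
  rewrite negbK; case: (even_prime p_prime) => // p2.
  by have := p_gt3; rewrite {1}p2.
have gs1 : (g * s true = s false ^+ k * g)%g.
  apply: eq_on => -[[] x]; rewrite !permM gE sE sXE gE iter_shift_half //.
  by rewrite /swap_double /shift_half /= addrACA kk.
have gs2 : (g * s false = s true ^+ 1 * g)%g.
  by apply: eq_on => -[[] x]; rewrite !permM gE sE expg1 sE gE.
have [G [GP G0 s1G s2G gG]] := nonevasive_fixed_graph P_property P_monotone
  P_nonevasive P0 p_prime (sp true) (sp false) sC gs1 gs2.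
exists G => //.
pose R v w := adjacent G (f v) (f w).
have RC v w : R v w = R w v by apply: adjacentC.
have Rg v w : R v w -> R (swap_double v) (swap_double w).
  by rewrite /R -!gE -{2}gG adjacent_relabel.
have Rs b v w : R v w -> R (shift_half b v) (shift_half b w).
  have sG : relabel (s b) G = G by case: b.
  by rewrite /R -!sE -{2}sG adjacent_relabel.
(* Invariance under the shifts lets each copy be translated independently by any amount. *)
have Rtr b (t : 'F_p) v w : R v w ->
    R (v.1, if v.1 == b then v.2 + t else v.2)
      (w.1, if w.1 == b then w.2 + t else w.2).
  rewrite -[t]natr_Zp -!iter_shift_half => Rvw.
  by elim: (t : nat) => //= j; apply: Rs.
pose Q (d : 'F_p) b := forall z, R (b, z) (b, z + d).
have RQ b x y : R (b, x) (b, y) -> Q (y - x) b.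
  move=> /(Rtr b (_ - x)) Rxy z; have := Rxy z.
  by rewrite /= eqxx addrCA subrr addr0 addrCA.
(* Passing from [true] to [false] keeps a difference and passing back doubles it, so $d$ in [true]
   yields $d$ and $2d$ in both copies. *)
have Q_false (d : 'F_p) : Q d true -> Q d false.
  by move=> Qd z; apply: (Rg _ _ (Qd z)).
have Q_true (d : 'F_p) : Q d false -> Q (d + d) true.
  move=> /(_ 0)/Rg/RQ; rewrite /= add0r addr0 subr0; exact.
have intra (d : 'F_p) : d != 0 -> Q d true -> (4 * p <= #|G|)%N.
  move=> d0 Qd; pose delta l : 'F_p := if l then d + d else d.
  have Qdelta l b : Q (delta l) b.
    by case: l b => [] []; rewrite /delta; auto.
  (* If two indexed edges coincided with their ends exchanged, this sum, one of $2d$, $3d$, $4d$,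
     would vanish. *)
  have sum_delta l m : delta l + delta m != 0.
    have -> : delta l + delta m = d *+ (2 + l + m).
      by case: l; case: m; rewrite /delta /= !mulrSr ?mulr0n ?add0r ?addrA.
    by rewrite mulrn_Fp_eq0 //; case: l; case: m.
  have delta_inj : injective delta.
    have dd : d + d != d by rewrite -subr_eq0 addrK.
    by case=> [] [] // E; case/eqP: dd; first [exact: E | exact: esym E].
  have -> : (4 * p = #|{: bool * bool * 'F_p}|)%N.
    by rewrite !card_prod !card_bool card_Fp.
  apply: (card_graph_ge (u := fun j => f (j.1.1, j.2))
                        (v := fun j => f (j.1.1, j.2 + delta j.1.2))).
    by move=> [[b l] z]; apply: Qdelta.
  move=> [[b l] z] [[c m] t] /= /set2_eq[] [/f_inj E1 /f_inj E2];
    have /= bc := congr1 fst E1; have /= zt := congr1 snd E1;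
    have /= := congr1 snd E2; rewrite bc zt.
    by move/addrI/delta_inj->.
  rewrite -addrA -[RHS]addr0 => /addrI/eqP.
  by rewrite (negPf (sum_delta m l)).
(* Independent translations of the copies produce all $p^2$ edges between them, and $p \geq 4$. *)
have inter x y : R (true, x) (false, y) -> (4 * p <= #|G|)%N.
  move=> Rxy; apply: (@leq_trans (p * p)); first by rewrite leq_pmul2r ?prime_gt0.
  have -> : (p * p = #|{: 'F_p * 'F_p}|)%N by rewrite card_prod card_Fp.
  apply: (card_graph_ge (u := fun j => f (true, j.1))
                        (v := fun j => f (false, j.2))).
    move=> [z t]; have := Rtr false (t - y) _ _ (Rtr true (z - x) _ _ Rxy).
    by rewrite /= [x + _]addrC [y + _]addrC !subrK.
  move=> [x1 y1] [x2 y2] /= /set2_eq[] [/f_inj E1 /f_inj E2].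
    by have /= -> := congr1 snd E1; have /= -> := congr1 snd E2.
  by have := congr1 fst E1.
have [i [j [ij Gij]]] := adjacent_ex G0.
have : R (f' i) (f' j) by rewrite /R !f'K.
have : f' i != f' j by rewrite (can_eq f'K).
case: (f' i) (f' j) => [b x] [c y]; have [<- | bc _] := eqVneq b c.
  rewrite xpair_eqE eqxx /= eq_sym -subr_eq0 => d0 /RQ.
  (* An edge inside [false] is first carried to [true], where its difference $2d$ is again
     nonzero. *)
  case: b => [Qd | /Q_true Qd]; first exact: intra Qd.
  by apply: intra Qd; rewrite -mulr2n mulrn_Fp_eq0.
case: b c bc => [] [] // _; first exact: inter.
by rewrite RC; apply: inter.
Qed.

Local Close Scope ring_scope.

Theorem corollary4p6 (p : nat) (P : {set graph (2 * p)})
    (p_prime : prime p) (p_gt3 : 3 < p)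
    (P_property : graph_property P) (P_nontrivial : ~ trivial P)
    (P_monotone : monotone P) (P_nonevasive : ~ evasive P) :
  ((4 * p)%:Z - 1 <= complex_dim P)%R.
Proof.
have P0 : P != set0 by apply/eqP=> P0; case: P_nontrivial; left.
have [G GP cG] := nonevasive_graph_card_ge p_prime p_gt3 P_property P_monotone
  P_nonevasive P0.
rewrite /complex_dim lerB // lez_nat; apply: leq_trans cG _.
exact: leq_bigmax_cond.
Qed.
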